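(* Let $\alpha,\beta\in\mathbb{R}$ with $\alpha\ne0$. Then the constant coefficient system $$\bm{x}'=A\bm{x},\qquad A=\begin{pmatrix}\alpha&\beta\\-\beta&\alpha\end{pmatrix},\qquad \bm{x}\in\mathbb{R}^2,$$ is Ulam stable on $\mathbb{R}$, and the best Ulam constant (with respect to the Euclidean norm) is $K_{c3}:=\frac{1}{|\alpha|}$.
   Context: $\|(v_1,v_2)^T\|_2=\sqrt{|v_1|^2+|v_2|^2}$ is the Euclidean norm. For $A\in\mathbb{R}^{2\times2}$, the equation $\bm{x}'=A\bm{x}$, $\bm{x}\in\mathbb{R}^2$, is called Ulam stable on $\mathbb{R}$ if there is a constant $K>0$ such that: for every $\varepsilon>0$ and every continuously differentiable $\bm{\phi}:\mathbb{R}\to\mathbb{R}^2$ with $\sup_{t\in\mathbb{R}}\|\bm{\phi}'(t)-A\bm{\phi}(t)\|_2\le\varepsilon$, there exists a solution $\bm{x}:\mathbb{R}\to\mathbb{R}^2$ of the equation with $\sup_{t\in\mathbb{R}}\|\bm{\phi}(t)-\bm{x}(t)\|_2\le K\varepsilon$. Any such $K$ is called an Ulam constant for the equation on $\mathbb{R}$. The best Ulam constant is the minimum of all Ulam constants, if this minimum exists. *)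

(* Defs.v *)
From HB Require Import structures.
From mathcomp Require Import all_boot all_order all_algebra.
From mathcomp Require Import all_classical all_reals all_analysis.

Set Implicit Arguments.
Unset Strict Implicit.
Unset Printing Implicit Defensive.

Import Order.TTheory GRing.Theory Num.Theory numFieldNormedType.Exports.

Local Open Scope classical_set_scope.
Local Open Scope ring_scope.

(* The library's own norm on matrices is the max norm; it only enters below
   through the topology on ['cV[R]_2] (limits, derivatives, continuity), which
   is the same for both norms. *)
Definition norm2 (R : realType) (v : 'cV[R]_2) : R :=
  Num.sqrt (`|v 0 0| ^+ 2 + `|v 1 0| ^+ 2).

(* Valued in the extended reals: [+oo] when [f] is unbounded. *)
Definition sup_norm2 (R : realType) (f : R -> 'cV[R]_2) : \bar R :=
  ereal_sup (range (fun t => (norm2 (f t))%:E)).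

Definition continuously_differentiable (R : realType) (f : R -> 'cV[R]_2) :
    Prop :=
  (forall t, derivable f t 1) /\ continuous f^`()%classic.

Definition is_solution (R : realType) (A : 'M[R]_2) (x : R -> 'cV[R]_2) :
    Prop :=
  forall t, derivable x t 1 /\ x^`()%classic t = A *m x t.

Definition ulam_constant (R : realType) (A : 'M[R]_2) (K : R) : Prop :=
  0 < K /\
  forall (eps : R) (phi : R -> 'cV[R]_2), 0 < eps ->
    continuously_differentiable phi ->
    (sup_norm2 (fun t => phi^`()%classic t - A *m phi t)%R <= eps%:E)%E ->
    exists x : R -> 'cV[R]_2, is_solution A x /\
      (sup_norm2 (fun t => phi t - x t)%R <= (K * eps)%:E)%E.

Definition ulam_stable (R : realType) (A : 'M[R]_2) : Prop :=
  exists K : R, ulam_constant A K.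

Definition best_ulam_constant (R : realType) (A : 'M[R]_2) (K : R) : Prop :=
  ulam_constant A K /\ lbound [set L | ulam_constant A L] K.

Definition mx22 (R : realType) (a b c d : R) : 'M[R]_2 :=
  \matrix_(i < 2, j < 2) nth 0 (nth [::] [:: [:: a; b]; [:: c; d]] i) j.

(* Main.v *)
(* Conjugating by the flow, y(t) = e^{-At} phi(t) satisfies
   |y'(t)| <= eps e^{-alpha t}. For alpha > 0, y therefore converges at +oo to
   some y0, with |y(t) - y0| <= (eps/alpha) e^{-alpha t}, and x(t) = e^{At} y0
   stays within eps/alpha of phi; alpha < 0 follows by reversing time.
   For optimality, phi(t) = -(1/alpha) (cos bt, - sin bt) with b = beta
   has residual of constant norm 1 and constant norm 1/|alpha|; any solution at
   bounded distance from it is bounded on R, hence zero. *)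
Require Import Defs.
From HB Require Import structures.
From mathcomp Require Import all_boot all_order all_algebra.
From mathcomp Require Import all_classical all_reals all_analysis.
From mathcomp Require Import ring lra.

Import Order.TTheory GRing.Theory Num.Theory numFieldNormedType.Exports.

Local Open Scope ring_scope.

(** * Real-analysis preliminaries *)

Lemma nonincreasing_of_derive_le0 {R : realType} (f df : R -> R) :
  (forall t : R, is_derive t 1 f (df t)) -> (forall t, df t <= 0) ->
  forall s t, s <= t -> f t <= f s.
Proof.
move=> fP df0 s t st.
apply: (@ler0_derive1_le_cc R f s t); rewrite ?in_itv/= ?lexx ?st//.
- by move=> x _; rewrite derive1E; have [_ ->] := fP x.
- by apply: derivable_within_continuous => x _; have [] := fP x.
Qed.

(** Solves for a time at which an exponential takes a prescribed small value, whatever the sign of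
    [a]; this replaces limits as time tends to infinity. *)
Lemma expR_scale_surj {R : realType} (a d : R) : a != 0 -> 0 < d ->
  exists t, expR (a * t) = d.
Proof. by move=> a0 d0; exists (ln d / a); rewrite mulrC divfK// lnK ?posrE. Qed.

Lemma cauchy_schwarz2 {R : realType} (u v x y r e : R) : 0 <= r -> 0 <= e ->
  u ^+ 2 + v ^+ 2 <= r ^+ 2 -> x ^+ 2 + y ^+ 2 <= e ^+ 2 ->
  u * x + v * y <= r * e.
Proof.
move=> r0 e0 uv xy; apply: le_trans (ler_norm _) _.
rewrite -[leRHS]ger0_norm ?mulr_ge0// -ler_sqr ?nnegrE// !real_normK ?num_real//.
have uv0 : 0 <= u ^+ 2 + v ^+ 2 by rewrite addr_ge0 ?sqr_ge0.
have xy0 : 0 <= x ^+ 2 + y ^+ 2 by rewrite addr_ge0 ?sqr_ge0.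
have := ler_pM uv0 xy0 uv xy.
(* Lagrange's identity: this square is the gap in Cauchy-Schwarz. *)
have := sqr_ge0 (u * y - v * x); rewrite exprMn; lra.
Qed.

(** * Limits of plane curves with exponentially decaying speed *)

Section Decay.
Context {R : realType} (a e : R) (y1 y2 d1 d2 : R -> R).
Hypotheses (a0 : 0 < a) (e0 : 0 <= e).
Hypothesis y1P : forall t : R, is_derive t 1 y1 (d1 t).
Hypothesis y2P : forall t : R, is_derive t 1 y2 (d2 t).
Hypothesis dle : forall t,
  d1 t ^+ 2 + d2 t ^+ 2 <= (e * expR (- a * t)) ^+ 2.

(* Working direction by direction avoids integrating vector-valued functions. *)
Lemma directional_increment_le (u v r s t : R) : 0 <= r ->
  u ^+ 2 + v ^+ 2 <= r ^+ 2 -> s <= t ->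
  u * (y1 s - y1 t) + v * (y2 s - y2 t) <=
    r * (e / a) * (expR (- a * s) - expR (- a * t)).
Proof.
move=> r0 uv st.
(* [h] decreases: the exponential term contributes [- r * (e * expR (- a * x))] to its derivative,
   which dominates the directional speed by Cauchy-Schwarz. *)
pose h x := (- u * y1 x + - v * y2 x) + r * (e / a) * expR (- a * x).
suff : h t <= h s by rewrite /h; lra.
apply: (nonincreasing_of_derive_le0 h (fun x => - u * d1 x + - v * d2 x
   - r * (e * expR (- a * x)))) st => x.
  by apply: is_derive_eq; rewrite /GRing.scale/=; field; rewrite gt_eqF.
rewrite subr_le0; apply: cauchy_schwarz2 => //.
- by rewrite mulr_ge0 ?expR_ge0.
- by rewrite !sqrrN.
Qed.

Lemma exp_cauchy_limit (y : R -> R) :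
  (forall s t, s <= t -> `|y s - y t| <=
     (e / a) * (expR (- a * s) - expR (- a * t))) ->
  exists c, forall t, `|y t - c| <= (e / a) * expR (- a * t).
Proof.
move=> yP.
have k0 : 0 <= e / a by rewrite divr_ge0// ltW.
pose E t := e / a * expR (- a * t).
have E0 t : 0 <= E t by rewrite mulr_ge0 ?expR_ge0.
(* [y - E] lies below [y + E] everywhere, so its supremum is the limit. *)
have cross s t : y s - E s <= y t + E t.
  have [st|/ltW ts] := leP s t; [move: (yP _ _ st)|move: (yP _ _ ts)];
    rewrite ler_norml => /andP[]; have := E0 s; have := E0 t; rewrite /E; lra.
exists (sup (range (fun s => y s - E s))) => t.
rewrite ler_distlC -/(E t); apply/andP; split.
  apply: ub_le_sup; last by exists t.
  by exists (y t + E t) => _ [s _ <-].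
by apply: ge_sup; [exists (y t - E t), t|move=> _ [s _ <-]].
Qed.

(** Axis directions give the limits [c] and [d], but combining those two bounds would lose a factor
    [sqrt 2]. Testing in the direction of the error itself and sending [t] to infinity recovers the
    sharp Euclidean bound. *)
Lemma decay_limit : exists c d, forall t,
  (y1 t - c) ^+ 2 + (y2 t - d) ^+ 2 <= ((e / a) * expR (- a * t)) ^+ 2.
Proof.
have k0 : 0 <= e / a by rewrite divr_ge0// ltW.
have a'0 : 0 <= a^-1 by rewrite invr_ge0 ltW.
have incr := directional_increment_le.
have [s t st|c cP] := @exp_cauchy_limit y1.
  have := incr 1 0 1 s t; have := incr (-1) 0 1 s t.
  rewrite sqrrN expr1n expr0n addr0 ler01 lexx st ler_norml => /(_ isT isT isT) ?.
  by move=> /(_ isT isT isT) ?; apply/andP; split; lra.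
have [s t st|d dP] := @exp_cauchy_limit y2.
  have := incr 0 1 1 s t; have := incr 0 (-1) 1 s t.
  rewrite sqrrN expr1n expr0n add0r ler01 lexx st ler_norml => /(_ isT isT isT) ?.
  by move=> /(_ isT isT isT) ?; apply/andP; split; lra.
exists c, d => s.
set D1 := y1 s - c; set D2 := y2 s - d.
pose r := Num.sqrt (D1 ^+ 2 + D2 ^+ 2).
have r0 : 0 <= r by rewrite sqrtr_ge0.
have rE : r ^+ 2 = D1 ^+ 2 + D2 ^+ 2 by rewrite sqr_sqrtr// addr_ge0 ?sqr_ge0.
have E0 t : 0 <= expR (- a * t) by rewrite expR_ge0.
rewrite -rE ler_sqr ?nnegrE ?mulr_ge0//.
have [->|rn0] := eqVneq r 0; first by rewrite mulr_ge0.
have rp : 0 < r by rewrite lt_neqAle eq_sym rn0.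
(* Split [r ^+ 2] as the error vector paired with the increment from [t] to [s], plus its pairing
   with the error at [t]; then divide by [r]. *)
have bound t : s <= t ->
    r <= e / a * expR (- a * s) + 2 * (e / a) * expR (- a * t).
  move=> st; rewrite -(ler_pM2l rp) -expr2.
  have D1r : `|D1| <= r.
    by rewrite -ler_sqr ?nnegrE// real_normK ?num_real// rE lerDl sqr_ge0.
  have D2r : `|D2| <= r.
    by rewrite -ler_sqr ?nnegrE// real_normK ?num_real// rE lerDr sqr_ge0.
  have h1 : D1 * (y1 t - c) <= r * (e / a * expR (- a * t)).
    by apply: le_trans (ler_norm _) _; rewrite normrM ler_pM.
  have h2 : D2 * (y2 t - d) <= r * (e / a * expR (- a * t)).
    by apply: le_trans (ler_norm _) _; rewrite normrM ler_pM.
  have := incr D1 D2 r s t r0; rewrite rE lexx st => /(_ isT isT) h3.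
  have h4 : r * (e / a) * expR (- a * t) >= 0 by rewrite !mulr_ge0.
  have -> : D1 ^+ 2 + D2 ^+ 2 = D1 * (y1 s - y1 t) + D2 * (y2 s - y2 t)
     + D1 * (y1 t - c) + D2 * (y2 t - d) by rewrite /D1 /D2; ring.
  move: h1 h2 h3 h4; lra.
apply/ler_addgt0Pr => x x0.
have K0 : 0 < 2 * (e / a) + 1 by rewrite ltr_wpDl// mulr_ge0.
(* The first entry forces [s <= t], the second makes the remainder at most [x]; the [+ 1] keeps the
   denominator positive when [e = 0]. *)
pose d' := Num.min (expR (- a * s)) (x / (2 * (e / a) + 1)).
have [||t td] := @expR_scale_surj R (- a) d'.
- by rewrite oppr_eq0 gt_eqF.
- by rewrite lt_min expR_gt0 divr_gt0.
have st : s <= t.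
  by rewrite -(ler_nM2l (_ : - a < 0)) ?oppr_lt0// -ler_expR td ge_min lexx.
have tx : expR (- a * t) <= x / (2 * (e / a) + 1) by rewrite td ge_min lexx orbT.
apply: le_trans (bound _ st) _; rewrite lerD2l.
move: tx; rewrite ler_pdivlMr// mulrC => tx; apply: le_trans tx.
by rewrite ler_wpM2r// lerDl.
Qed.
End Decay.

(** * Explicit solutions, shadowing and bounded orbits *)

(* [(spiral1, spiral2)] is [e^{At} (c, d)] for [A = ((a, b), (- b, a))]. *)
Definition spiral1 {R : realType} (a b c d t : R) : R :=
  expR (a * t) * (c * cos (b * t) + d * sin (b * t)).
Definition spiral2 {R : realType} (a b c d t : R) : R :=
  expR (a * t) * (- c * sin (b * t) + d * cos (b * t)).

(** Squared Euclidean norm of [phi' - A phi] where [phi = (x, y)] and [phi' = (dx, dy)]. *)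
Definition residual_sqr {R : realType} (a b x y dx dy : R) :=
  (dx - (a * x + b * y)) ^+ 2 + (dy - (- b * x + a * y)) ^+ 2.

Lemma shadow_pos {R : realType} (a b e : R) (p q dp dq : R -> R) :
  0 < a -> 0 <= e ->
  (forall t : R, is_derive t 1 p (dp t)) -> (forall t : R, is_derive t 1 q (dq t)) ->
  (forall t, residual_sqr a b (p t) (q t) (dp t) (dq t) <= e ^+ 2) ->
  exists c d, forall t, (p t - spiral1 a b c d t) ^+ 2 +
    (q t - spiral2 a b c d t) ^+ 2 <= (e / a) ^+ 2.
Proof.
move=> a0 e0 pP qP res.
pose r1 t := dp t - (a * p t + b * q t).
pose r2 t := dq t - (- b * p t + a * q t).
pose E t := expR (- a * t).
(* The curve is [e^{-At} (p, q)]; its derivative is [e^{-At}] applied to the residual [(r1, r2)]. *)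
have [] := decay_limit a e
  (fun t => E t * (p t * cos (b * t) + -1 * (q t * sin (b * t))))
  (fun t => E t * (p t * sin (b * t) + q t * cos (b * t)))
  (fun t => E t * (r1 t * cos (b * t) - r2 t * sin (b * t)))
  (fun t => E t * (r1 t * sin (b * t) + r2 t * cos (b * t))) a0 e0.
- by move=> t; apply: is_derive_eq; rewrite /GRing.scale/= /E /r1 /r2; ring.
- by move=> t; apply: is_derive_eq; rewrite /GRing.scale/= /E /r1 /r2; ring.
- move=> t.
  rewrite (_ : _ + _ = E t ^+ 2 * (r1 t ^+ 2 + r2 t ^+ 2) *
    (cos (b * t) ^+ 2 + sin (b * t) ^+ 2)); last by ring.
  by rewrite cos2Dsin2 mulr1 exprMn mulrC ler_wpM2r ?sqr_ge0//; exact: res.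
move=> c [d cdP]; exists c, d => t.
have EK : expR (a * t) * E t = 1 by rewrite /E mulNr expRxMexpNx_1.
have -> : (e / a) ^+ 2 = expR (a * t) ^+ 2 * (e / a * E t) ^+ 2.
  by rewrite -exprMn mulrCA EK mulr1.
apply: le_trans (ler_wpM2l (sqr_ge0 (expR (a * t))) (cdP t)).
rewrite mulrDr -!exprMn !mulrBr !mulrA EK !mul1r le_eqVlt; apply/orP; left.
apply/eqP; rewrite /spiral1 /spiral2.
set x := expR _; set C := cos _; set S := sin _.
have CS : C ^+ 2 + S ^+ 2 = 1 := cos2Dsin2 _.
(* Rotation invariance of the norm: the two sides differ by a multiple of
   [1 - (C ^+ 2 + S ^+ 2)]. *)
transitivity ((p t * C + -1 * (q t * S) - x * c) ^+ 2 + (p t * S + q t * C - x * d) ^+ 2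
  + (1 - (C ^+ 2 + S ^+ 2)) * (p t ^+ 2 + q t ^+ 2 - x ^+ 2 * (c ^+ 2 + d ^+ 2))).
  by ring.
by rewrite CS subrr mul0r addr0 !mulrA.
Qed.

Lemma shadow {R : realType} (a b e : R) (p q dp dq : R -> R) :
  a != 0 -> 0 <= e ->
  (forall t : R, is_derive t 1 p (dp t)) ->
  (forall t : R, is_derive t 1 q (dq t)) ->
  (forall t, residual_sqr a b (p t) (q t) (dp t) (dq t) <= e ^+ 2) ->
  exists c d, forall t, (p t - spiral1 a b c d t) ^+ 2 +
    (q t - spiral2 a b c d t) ^+ 2 <= (e / `|a|) ^+ 2.
Proof.
move=> a0 e0 pP qP res; have [a_gt0|a_lt0|aE] := ltrgtP a 0; last first.
- by rewrite aE eqxx in a0.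
- by rewrite gtr0_norm//; apply: shadow_pos res.
have Na_gt0 : 0 < - a by rewrite oppr_gt0.
(* Reversing time replaces [(a, b)] by [(- a, - b)] and only flips the sign of the residual. *)
have [||t|c [d cdP]] := @shadow_pos R (- a) (- b) e (fun t => p (- t)) (fun t => q (- t))
  (fun t => - dp (- t)) (fun t => - dq (- t)) Na_gt0 e0.
- move=> t; have := is_derive1_comp (pP (- t)) (is_deriveN (is_derive_id t 1)).
  by rewrite mulrN1.
- move=> t; have := is_derive1_comp (qP (- t)) (is_deriveN (is_derive_id t 1)).
  by rewrite mulrN1.
- apply: le_trans (res (- t)); rewrite /residual_sqr le_eqVlt.
  by apply/orP; left; apply/eqP; ring.
exists c, d => t; move: (cdP (- t)).
by rewrite /spiral1 /spiral2 !mulrNN opprK ltr0_norm.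
Qed.

(* The squared norm of a solution is a multiple of [expR (2 * a * t)]. *)
Lemma bounded_orbit_eq0 {R : realType} (a b M : R) (p q dp dq : R -> R) :
  a != 0 ->
  (forall t : R, is_derive t 1 p (dp t)) ->
  (forall t : R, is_derive t 1 q (dq t)) ->
  (forall t, residual_sqr a b (p t) (q t) (dp t) (dq t) = 0) ->
  (forall t, p t ^+ 2 + q t ^+ 2 <= M) ->
  forall t, p t ^+ 2 + q t ^+ 2 = 0.
Proof.
move=> a0 pP qP res bnd s.
pose N t := p t ^+ 2 + q t ^+ 2.
have N0 t : 0 <= N t by rewrite addr_ge0 ?sqr_ge0.
have dpE t : dp t = a * p t + b * q t /\ dq t = - b * p t + a * q t.
  have /eqP := res t; rewrite paddr_eq0 ?sqr_ge0// !sqrf_eq0 !subr_eq0.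
  by move=> /andP[/eqP -> /eqP ->].
pose g t := expR (- (2 * a) * t) * N t.
have gP (t : R) : is_derive t 1 g 0.
  apply: is_derive_eq; rewrite /GRing.scale/=.
  by have [-> ->] := dpE t; rewrite /N; ring.
have gc t : g t = g s by exact: is_derive_0_is_cst.
have M0 : 0 <= M := le_trans (N0 s) (bnd s).
apply/eqP; rewrite eq_le N0 andbT leNgt; apply/negP => Ns.
have gs : 0 < g s by rewrite mulr_gt0 ?expR_gt0.
have M1 : 0 < M + 1 by rewrite ltr_wpDl.
(* At this [t], constancy of [g] gives [N t = M + 1], contradicting the bound [M]. *)
have [||t tE] := @expR_scale_surj R (- (2 * a)) (g s / (M + 1)).
- by rewrite oppr_eq0 mulf_neq0// pnatr_eq0.
- by rewrite divr_gt0.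
have := gc t; rewrite {1}/g tE => gE.
have : g s / (M + 1) * N t <= g s / (M + 1) * M.
  by rewrite ler_wpM2l ?bnd// divr_ge0// ltW.
rewrite gE mulrAC ler_pdivlMr// ler_pM2l//; lra.
Qed.

(** * Passage between column vectors and coordinates *)

Lemma is_derive_entry {R : realType} (x : R -> 'cV[R]_2) (t : R) i :
  derivable x t 1 -> is_derive t 1 (fun s => x s i 0) (x^`()%classic t i 0).
Proof.
move=> dx; apply: DeriveDef; first exact: (derivable_mxP _ _ _).1 dx i 0.
by rewrite derive1E derive_mx// mxE.
Qed.

Lemma ord2_cases (i : 'I_2) : i = 0 \/ i = 1.
Proof. by case: i => -[|[|//]] i2; [left|right]; apply/val_inj. Qed.

Lemma is_derive_col {R : realType} (x : R -> 'cV[R]_2) (dx : 'cV[R]_2) (t : R) :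
  is_derive t 1 (fun s => x s 0 0) (dx 0 0) ->
  is_derive t 1 (fun s => x s 1 0) (dx 1 0) -> is_derive t 1 x dx.
Proof.
move=> [d0 e0] [d1 e1].
have dx1 : derivable x t 1.
  apply/derivable_mxP => i j; rewrite (ord1 j).
  by have [->|->] := ord2_cases i.
apply: DeriveDef => //; rewrite derive_mx//; apply/matrixP => i j.
rewrite (ord1 j) mxE.
by have [->|->] := ord2_cases i.
Qed.

(** Turns the supremum into pointwise sums of squares; [0 <= e] makes squaring reversible. *)
Lemma sup_norm2_leP {R : realType} (f : R -> 'cV[R]_2) (e : R) : 0 <= e ->
  (sup_norm2 f <= e%:E)%E <->
  forall t, f t 0 0 ^+ 2 + f t 1 0 ^+ 2 <= e ^+ 2.
Proof.
move=> e0.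
have E v : (norm2 v <= e) = (v 0 0 ^+ 2 + v 1 0 ^+ 2 <= e ^+ 2) :> bool.
  rewrite /norm2 !real_normK ?num_real// -[in RHS]ler_sqrt ?sqr_ge0//.
  by rewrite sqrtr_sqr ger0_norm.
split=> [fe t|fe].
  rewrite -E -lee_fin; apply: le_trans fe.
  by apply: ereal_sup_ubound; exists t.
by apply: ge_ereal_sup => _ [t _ <-]; rewrite lee_fin E.
Qed.

Lemma mx22_mulE {R : realType} (a b c d : R) (v : 'cV[R]_2) :
  (mx22 a b c d *m v) 0 0 = a * v 0 0 + b * v 1 0 /\
  (mx22 a b c d *m v) 1 0 = c * v 0 0 + d * v 1 0.
Proof.
rewrite !mxE !big_ord_recl !big_ord0 !mxE/= !addr0.
by split; congr (_ + _ * v _ _); apply/val_inj.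
Qed.

Definition colvec2 {R : realType} (x y : R) : 'cV[R]_2 :=
  \col_i (if i == 0 then x else y).

Lemma residual_sqr_mx22 {R : realType} (a b : R) (dv v : 'cV[R]_2) :
  let w := dv - mx22 a b (- b) a *m v in
  w 0 0 ^+ 2 + w 1 0 ^+ 2 = residual_sqr a b (v 0 0) (v 1 0) (dv 0 0) (dv 1 0).
Proof.
have subE (B : 'cV[R]_2) i : (dv - B) i 0 = dv i 0 - B i 0 by rewrite !mxE.
by move=> w; rewrite /w !subE; have [-> ->] := mx22_mulE a b (- b) a v.
Qed.

Lemma is_solution_spiral {R : realType} (a b c d : R) :
  is_solution (mx22 a b (- b) a)
    (fun t => colvec2 (spiral1 a b c d t) (spiral2 a b c d t)).
Proof.
move=> t; set x := fun s : R => _.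
have [e0 e1] := mx22_mulE a b (- b) a (x t).
have xP : is_derive t 1 x (mx22 a b (- b) a *m x t).
  apply: is_derive_col; rewrite ?e0 ?e1 /x /colvec2.
    under eq_fun do rewrite !mxE /=; rewrite !mxE /= /spiral1 /spiral2.
    by apply: is_derive_eq; rewrite /GRing.scale/=; ring.
  under eq_fun do rewrite !mxE /=; rewrite !mxE /= /spiral1 /spiral2.
  by apply: is_derive_eq; rewrite /GRing.scale/=; ring.
by have [? xE] := xP; rewrite derive1E xE.
Qed.

(** * The Ulam constant and its optimality *)

Lemma ulam_constant_upper {R : realType} (a b : R) : a != 0 ->
  ulam_constant (mx22 a b (- b) a) (1 / `|a|).
Proof.
move=> a0; split=> [|e phi e0 [dphi _]]; first by rewrite divr_gt0 ?normr_gt0.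
move=> /(sup_norm2_leP _ _ (ltW e0)) res.
have [t|c [d cdP]] := shadow a b e (fun t => phi t 0 0) (fun t => phi t 1 0) _ _
  a0 (ltW e0) (fun t => is_derive_entry _ _ 0 (dphi t))
  (fun t => is_derive_entry _ _ 1 (dphi t)).
  by rewrite -residual_sqr_mx22; exact: res.
eexists; split; first exact: (is_solution_spiral a b c d).
apply/sup_norm2_leP; first by rewrite mulr_ge0 ?ltW ?divr_gt0 ?normr_gt0.
move=> t; rewrite mul1r mulrC; apply: le_trans (cdP t).
by rewrite /colvec2 !mxE.
Qed.

Lemma ulam_constant_lower {R : realType} (a b L : R) : a != 0 ->
  ulam_constant (mx22 a b (- b) a) L -> 1 / `|a| <= L.
Proof.
move=> a0 [L0 ulamL].
(* [phi] rotates with the skew part of the matrix, so [phi' - A phi = - a phi], of norm 1. *)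
pose phi t := colvec2 (- a^-1 * cos (b * t)) (a^-1 * sin (b * t)).
pose dphi t := colvec2 (a^-1 * b * sin (b * t)) (a^-1 * b * cos (b * t)).
have phiP (t : R) : is_derive t 1 phi (dphi t).
  apply: is_derive_col; rewrite /phi /dphi /colvec2.
    under eq_fun do rewrite !mxE /=; rewrite !mxE /=.
    by apply: is_derive_eq; rewrite /GRing.scale/=; ring.
  under eq_fun do rewrite !mxE /=; rewrite !mxE /=.
  by apply: is_derive_eq; rewrite /GRing.scale/=; ring.
have dphiE : phi^`()%classic = dphi.
  by apply/funext => t; rewrite derive1E; have [_ ->] := phiP t.
have dphiP (t : R) : derivable dphi t 1.
  apply/derivable_mxP => i j; rewrite /dphi /colvec2.
  by under eq_fun do rewrite mxE; have [->|->] := ord2_cases i;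
    apply: ex_derive.
have [||x [xP /sup_norm2_leP phix]] := ulamL 1 phi ltr01.
- split=> [t|]; first by have [] := phiP t.
  rewrite dphiE => t.
  exact/differentiable_continuous/derivable1_diffP/dphiP.
- apply/sup_norm2_leP => // t; rewrite dphiE.
  rewrite residual_sqr_mx22 /residual_sqr.
  rewrite /phi /dphi /colvec2 !mxE /= expr1n -(cos2Dsin2 (b * t)) le_eqVlt.
  by apply/orP; left; apply/eqP; field.
have {}phix t : (phi t 0 0 - x t 0 0) ^+ 2 + (phi t 1 0 - x t 1 0) ^+ 2 <= L ^+ 2.
  have := phix _ t; rewrite mulr1 !mxE; apply; exact: ltW.
have phiN t : phi t 0 0 ^+ 2 + phi t 1 0 ^+ 2 = a^-1 ^+ 2.
  rewrite /phi /colvec2 !mxE /= -[RHS]mulr1 -(cos2Dsin2 (b * t)); ring.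
(* The bound comes from the parallelogram law: [|x|^2 + |2 phi - x|^2 = 2 |phi|^2 + 2 |phi -
   x|^2]. *)
have x0 := bounded_orbit_eq0 a b (2 * (a^-1 ^+ 2 + L ^+ 2))
  (fun t => x t 0 0) (fun t => x t 1 0) _ _ a0
  (fun t => is_derive_entry _ _ 0 (xP t).1)
  (fun t => is_derive_entry _ _ 1 (xP t).1).
have /(_ 0)/eqP : forall t, x t 0 0 ^+ 2 + x t 1 0 ^+ 2 = 0.
  apply: x0 => t.
    rewrite (xP t).2 /residual_sqr.
    have [-> ->] := mx22_mulE a b (- b) a (x t).
    by rewrite !subrr expr0n addr0.
  have := phix t; have := phiN t.
  have := sqr_ge0 (2 * phi t 0 0 - x t 0 0); have := sqr_ge0 (2 * phi t 1 0 - x t 1 0).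
  nra.
rewrite paddr_eq0 ?sqr_ge0// !sqrf_eq0 => /andP[/eqP x00 /eqP x10].
(* Since [x] vanishes at 0, the distance there is the norm of [phi], giving
   [a^-1 ^+ 2 <= L ^+ 2]. *)
have := phix 0; rewrite x00 x10 !subr0 phiN => aL.
have L_ge0 := ltW L0.
by rewrite div1r -ler_sqr ?nnegrE ?invr_ge0// -normfV real_normK ?num_real.
Qed.

Theorem corollary5p4 (R : realType) (alpha beta : R) (alpha_neq0 : alpha <> 0) :
  let A : 'M[R]_2 := mx22 alpha beta (- beta) alpha in
  ulam_stable A /\ best_ulam_constant A (1 / `|alpha|).
Proof.
have a0 : alpha != 0 by apply/eqP.
move=> A; have ulamA : ulam_constant A (1 / `|alpha|) by exact: ulam_constant_upper.
by split; [exists (1 / `|alpha|)|split=> // L; exact: ulam_constant_lower].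
Qed.
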